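(* Let $\Bbbk$ be a field and let $R$ be a $\Bbbk$-algebra (associative, with identity), with data $I_\ell, J_\ell, X_\ell, S_\ell, Y_\ell, D_\ell, T_\ell$ ($1\le\ell\le t$) as described in the context. Assume: (A) $T_\ell$ is right noetherian for all $\ell$; (B) $Y_\ell=\{Q\in\operatorname{Spec}S_\ell\mid D_\ell\subseteq\mathcal{C}_{S_\ell}(Q)\}$ for all $\ell$; (C) $T_\ell$ is ideally commutative for all $\ell$; (D) $R$ satisfies the Nullstellensatz over $\Bbbk$. Then $R$ satisfies the Dixmier–Moeglin equivalence over $\Bbbk$: for every prime ideal $P$ of $R$, the following are equivalent: $P$ is primitive; $P$ is rational over $\Bbbk$; $P$ is locally closed.
   Context: Conventions. For a ring $\Lambda$: $Z(\Lambda)$ is its center; $\mathcal{C}_\Lambda(I)$ is the set of elements of $\Lambda$ regular modulo the ideal $I$; $\operatorname{Spec}\Lambda$ is the set of prime ideals with the Zariski/Jacobson topology, whose closed sets are $V(E)=\{P\in\operatorname{Spec}\Lambda\mid P\supseteq E\}$, $E\subseteq\Lambda$. ''Primitive'' means right primitive. A prime ideal $P$ of $\Lambda$ is locally closed if it is a locally closed point of $\operatorname{Spec}\Lambda$, i.e. $P\subsetneq\bigcap\{Q'\in\operatorname{Spec}\Lambda\mid Q'\supsetneq P\}$ (the empty intersection being $\Lambda$). A prime ideal $P$ of a $\Bbbk$-algebra $\Lambda$ is rational over $\Bbbk$ if $\Lambda/P$ is right (or left) Goldie and the center of the Goldie right (or left) quotient ring of $\Lambda/P$ is algebraic over $\Bbbk$.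 A $\Bbbk$-algebra $\Lambda$ satisfies the Nullstellensatz over $\Bbbk$ if $\operatorname{End}(M_\Lambda)$ is algebraic over $\Bbbk$ for every simple right $\Lambda$-module $M$, and the Jacobson radical of every factor ring of $\Lambda$ is nil. A right denominator set of $\Lambda$ is a multiplicatively closed right Ore set $D$ for which the canonical right Ore localization map $\Lambda\to\Lambda D^{-1}$ is injective (equivalently, a right Ore set of regular elements). $\Lambda$ is ideally commutative if $\mathfrak{a}\mapsto\mathfrak{a}\cap Z(\Lambda)$ and $\mathfrak{b}\mapsto\mathfrak{b}\Lambda$ are mutually inverse, product preserving bijections between the set of ideals $\mathfrak{a}$ of $\Lambda$ and the set of ideals $\mathfrak{b}$ of $Z(\Lambda)$. Setup. $I_1,J_1,\ldots,I_t,J_t$ are ideals of $R$ such that $\operatorname{Spec}R=X_1\cup\cdots\cup X_t$, where $X_\ell=V(I_\ell)\setminus V(J_\ell)$ (not necessarily disjoint). Put $S_\ell=R/I_\ell$, and $Y_\ell=\operatorname{Spec}S_\ell\setminus V_{S_\ell}((J_\ell+I_\ell)/I_\ell)$. Let $D_\ell$ be a right denominator set of $S_\ell$ and let $T_\ell=S_\ell D_\ell^{-1}$. *)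

(* Defs.v *)
From HB Require Import structures.
From mathcomp Require Import all_boot all_order all_algebra.
From mathcomp Require Import generic_quotient ring_quotient.
From mathcomp Require Import boolp classical_sets.

Set Implicit Arguments.
Unset Strict Implicit.
Unset Printing Implicit Defensive.

Import GRing.Theory.
Local Open Scope classical_set_scope.
Local Open Scope ring_scope.
Local Open Scope quotient_scope.

(* Rings are associative and unital, and may be zero (R / I is zero for I = R),
   hence [pzRingType].  As MathComp's [algType k] excludes the zero ring, a
   k-algebra is a [pzRingType] A with a ring morphism k -> A of central image.
   Right A-modules are left modules over the converse ring A^c. *)

Section Ideals.
Variable R : pzRingType.
Implicit Types (A B : set R).

Definition is_ideal A :=
  [/\ A 0, forall x y, A x -> A y -> A (x + y),
      forall r x, A x -> A (r * x) & forall x r, A x -> A (x * r)].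

Record ideal := Ideal { ideal_set :> set R; idealP : is_ideal ideal_set }.

Definition is_right_ideal A :=
  [/\ A 0, forall x y, A x -> A y -> A (x + y) & forall x r, A x -> A (x * r)].

Definition products A B : set R :=
  [set x | exists n (a b : 'I_n -> R),
    (forall i, A (a i) /\ B (b i)) /\ x = \sum_(i < n) a i * b i].

Definition sums A B : set R := [set x + y | x in A & y in B].

Definition center : set R := [set z | forall x, z * x = x * z].

Definition regular_elements : set R :=
  [set s | (forall x, s * x = 0 -> x = 0) /\ (forall x, x * s = 0 -> x = 0)].

Definition regular_mod (I : ideal) : set R :=
  [set s | (forall x, ideal_set I (s * x) -> ideal_set I x) /\
           (forall x, ideal_set I (x * s) -> ideal_set I x)].

End Ideals.

Section FactorRing.
Variables (R : pzRingType) (I : ideal R).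

Definition ideal_pred : {pred R} := fun x => `[< ideal_set I x >].

Lemma ideal_predE x : (x \in ideal_pred) = `[< ideal_set I x >].
Proof. by []. Qed.

Fact ideal_zmod_closed : zmod_closed ideal_pred.
Proof.
have [I0 ID IM _] := idealP I.
split=> [|x y]; rewrite !ideal_predE; first exact/asboolP.
move=> /asboolP Ix /asboolP Iy; apply/asboolP; apply: ID => //.
by rewrite -mulN1r; apply: IM.
Qed.

HB.instance Definition _ := GRing.isZmodClosed.Build R ideal_pred
  ideal_zmod_closed.

Definition factor_ring := Quotient.quot ideal_pred.

HB.instance Definition _ := GRing.Zmodule.on factor_ring.
HB.instance Definition _ := EqQuotient.on factor_ring.

Definition factor_proj (x : R) : factor_ring := \pi_factor_ring x.

Lemma factor_proj_eq x y : factor_proj x = factor_proj y <-> ideal_set I (x - y).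
Proof.
rewrite /factor_proj; split=> [/eqP|Ixy].
  by rewrite -Quotient.idealrBE => /asboolP.
by apply/eqP; rewrite -Quotient.idealrBE; apply/asboolP.
Qed.

Lemma factor_proj_surj (u : factor_ring) : exists x, factor_proj x = u.
Proof. by exists (repr u); rewrite /factor_proj reprK. Qed.

Fact factor_proj_zmod_morphism : zmod_morphism factor_proj.
Proof. by move=> x y; rewrite /factor_proj !piE. Qed.

HB.instance Definition _ := GRing.isZmodMorphism.Build R factor_ring
  factor_proj factor_proj_zmod_morphism.

Definition factor_mul (u v : factor_ring) : factor_ring :=
  factor_proj (repr u * repr v).

Fact factor_projM x y :
  factor_proj (x * y) = factor_mul (factor_proj x) (factor_proj y).
Proof.
have [_ ID IMl IMr] := idealP I.
set x' := repr (factor_proj x); set y' := repr (factor_proj y).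
have Ix : ideal_set I (x - x').
  by apply/factor_proj_eq; rewrite /factor_proj reprK.
have Iy : ideal_set I (y - y').
  by apply/factor_proj_eq; rewrite /factor_proj reprK.
apply/factor_proj_eq.
rewrite -(subrK (x * y') (x * y)) -addrA -mulrBr -mulrBl.
by apply: ID; [apply: IMl | apply: IMr].
Qed.

Fact factor_mulA : associative factor_mul.
Proof.
move=> u v w; have [x <-] := factor_proj_surj u.
have [y <-] := factor_proj_surj v; have [z <-] := factor_proj_surj w.
by rewrite -!factor_projM mulrA.
Qed.

Fact factor_mul1 : left_id (factor_proj 1) factor_mul.
Proof.
by move=> u; have [x <-] := factor_proj_surj u; rewrite -factor_projM mul1r.
Qed.

Fact factor_mulr1 : right_id (factor_proj 1) factor_mul.
Proof.
by move=> u; have [x <-] := factor_proj_surj u; rewrite -factor_projM mulr1.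
Qed.

Fact factor_mulDl : left_distributive factor_mul +%R.
Proof.
move=> u v w; have [x <-] := factor_proj_surj u.
have [y <-] := factor_proj_surj v; have [z <-] := factor_proj_surj w.
by rewrite -raddfD -!factor_projM -raddfD mulrDl.
Qed.

Fact factor_mulDr : right_distributive factor_mul +%R.
Proof.
move=> u v w; have [x <-] := factor_proj_surj u.
have [y <-] := factor_proj_surj v; have [z <-] := factor_proj_surj w.
by rewrite -raddfD -!factor_projM -raddfD mulrDr.
Qed.

HB.instance Definition _ := GRing.Zmodule_isPzRing.Build factor_ring
  factor_mulA factor_mul1 factor_mulr1 factor_mulDl factor_mulDr.

Fact factor_proj_monoid_morphism : monoid_morphism factor_proj.
Proof. by split=> // x y; rewrite factor_projM. Qed.

HB.instance Definition _ := GRing.isMonoidMorphism.Build R factor_ring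
  factor_proj factor_proj_monoid_morphism.

End FactorRing.

Section Spectrum.
Variable R : pzRingType.

Definition prime_ideal (P : ideal R) :=
  (exists x, ~ ideal_set P x) /\
  forall A B : ideal R, products A B `<=` P -> A `<=` P \/ B `<=` P.

Definition Spec : set (ideal R) := [set P | prime_ideal P].

Definition zariski_closed (E : set R) : set (ideal R) :=
  [set P | Spec P /\ E `<=` P].

Definition locally_closed (P : ideal R) :=
  P `<` \bigcap_(Q in [set Q : ideal R | Spec Q /\ P `<` Q]) Q.

End Spectrum.
Arguments Spec : clear implicits.

Section Modules.
Variable R : pzRingType.

Definition is_submodule (M : lmodType R^c) (N : set M) :=
  [/\ N 0, forall x y, N x -> N y -> N (x + y)
    & forall (r : R^c) x, N x -> N (r *: x)].

Definition simple_module (M : lmodType R^c) :=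
  (exists m : M, m <> 0) /\
  forall N : set M, is_submodule N -> N = [set 0] \/ N = setT.

Definition annihilator (M : lmodType R^c) : set R :=
  [set r | forall m : M, (r : R^c) *: m = 0].

Definition primitive_ideal (P : ideal R) :=
  exists M : lmodType R^c, simple_module M /\ annihilator M = P.

Definition maximal_right_ideal (A : set R) :=
  [/\ is_right_ideal A, A <> setT
    & forall B, is_right_ideal B -> A `<=` B -> B = A \/ B = setT].

Definition jacobson_radical : set R :=
  \bigcap_(A in [set A | maximal_right_ideal A]) A.

Definition nil_set (A : set R) := forall x, A x -> exists n, x ^+ n = 0.

End Modules.
Arguments jacobson_radical : clear implicits.

Section Conditions.
Variable R : pzRingType.

Definition stationary (A : nat -> set R) :=
  exists N, forall n, (N <= n)%N -> A n = A N.

Definition right_noetherian :=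
  forall A : nat -> set R, (forall n, is_right_ideal (A n)) ->
    (forall n, A n `<=` A n.+1) -> stationary A.

Definition right_annihilator (X : set R) : set R :=
  [set r | forall x, X x -> x * r = 0].

Definition acc_right_annihilators :=
  forall X : nat -> set R,
    (forall n, right_annihilator (X n) `<=` right_annihilator (X n.+1)) ->
    stationary (fun n => right_annihilator (X n)).

Definition independent (A : nat -> set R) :=
  forall n (x : 'I_n -> R), (forall i : 'I_n, A i (x i)) ->
    \sum_(i < n) x i = 0 -> forall i, x i = 0.

Definition no_infinite_direct_sum :=
  ~ exists A : nat -> set R,
      (forall n, is_right_ideal (A n) /\ A n <> [set 0]) /\ independent A.

Definition right_goldie := acc_right_annihilators /\ no_infinite_direct_sum.

Definition right_ore_set (D : set R) :=
  [/\ D 1, forall d e, D d -> D e -> D (d * e)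
    & forall s d, D d -> exists s' d', D d' /\ s * d' = d * s'].

Definition right_denominator_set (D : set R) :=
  right_ore_set D /\ D `<=` @regular_elements R.

(* For a right denominator set D, phi presents T as R D^-1: this determines
   (T, phi) up to a unique isomorphism. *)
Definition right_localization (D : set R) (T : pzRingType)
    (phi : {rmorphism R -> T}) :=
  [/\ injective phi,
      forall d, D d -> exists u, u * phi d = 1 /\ phi d * u = 1
    & forall q, exists s d, D d /\ q * phi d = phi s].

Definition center_ideal (b : set R) :=
  [/\ b `<=` @center R, b 0, forall x y, b x -> b y -> b (x + y)
    & forall z x, center z -> b x -> b (z * x)].

Definition contract (a : set R) : set R := a `&` @center R.
Definition extend (b : set R) : set R := products b setT.

Definition ideally_commutative :=
  [/\ forall a : ideal R, extend (contract a) = a,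
      forall b, center_ideal b -> contract (extend b) = b,
      forall a a' : ideal R,
        contract (products a a') = products (contract a) (contract a')
    & forall b b', center_ideal b -> center_ideal b' ->
        extend (products b b') = products (extend b) (extend b')].

End Conditions.
Arguments right_noetherian : clear implicits.
Arguments right_goldie : clear implicits.
Arguments ideally_commutative : clear implicits.

Section Algebras.
Variable k : fieldType.

Definition central_map (R : pzRingType) (iota : k -> R) :=
  forall c, center (iota c).

Definition algebraic (R : pzRingType) (iota : k -> R) (z : R) :=
  exists2 p : {poly k}, p != 0 & \sum_(i < size p) iota p`_i * z ^+ i = 0.

Definition algebraic_endo (R : pzRingType) (iota : k -> R)
    (M : lmodType R^c) (f : {linear M -> M}) :=
  exists2 p : {poly k}, p != 0 &
    forall m : M, \sum_(i < size p) (iota p`_i : R^c) *: iter i f m = 0.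

Definition right_goldie_algebraic_center (R : pzRingType) (iota : k -> R) :=
  right_goldie R /\
  exists (Q : pzRingType) (phi : {rmorphism R -> Q}),
    right_localization (@regular_elements R) phi /\
    forall z, center z -> algebraic (phi \o iota) z.

(* The left-handed alternative is the right-handed one for the converse ring:
   the left quotient ring of L is the converse of the right quotient ring of
   L^c, and has the same center. *)
Definition rational (R : pzRingType) (iota : k -> R) (P : ideal R) :=
  let L := factor_ring P in
  let iotaP : k -> L := factor_proj P \o iota in
  right_goldie_algebraic_center (iotaP : k -> L) \/
  right_goldie_algebraic_center (iotaP : k -> L^c).

Definition nullstellensatz (R : pzRingType) (iota : k -> R) :=
  (forall M : lmodType R^c, simple_module M ->
     forall f : {linear M -> M}, algebraic_endo iota f) /\
  (forall I : ideal R, nil_set (jacobson_radical (factor_ring I))).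

Definition dixmier_moeglin (R : pzRingType) (iota : k -> R) :=
  forall P : ideal R, prime_ideal P ->
    (primitive_ideal P <-> rational iota P) /\
    (rational iota P <-> locally_closed P).

End Algebras.

(* Main.v *)
Require Import Defs.
From HB Require Import structures.
From mathcomp Require Import all_boot all_order all_algebra.
From mathcomp Require Import generic_quotient ring_quotient.
From mathcomp Require Import boolp classical_sets.

(* Let P be a prime in X_l and A = R / P. Contracting chains of right ideals from
   the right noetherian ring T_l shows that A is right Goldie, so A has no nonzero
   nil right ideal and, by Goldie's theorem, has a right quotient ring.
   - Locally closed implies primitive: the Jacobson radical of A is nil, hence 0,
     so P is an intersection of primitive ideals.
   - Primitive implies rational: a central element a / c of the quotient ring is
     encoded by the identity a x c = c x a in A; it acts on a faithful simple
     module by an endomorphism, which is algebraic by the Nullstellensatz.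
   - Rational implies locally closed: if a prime P' > P does not contain J_l, then
     P' T_l is a proper ideal larger than P T_l, so by ideal commutativity it
     contains a central z outside P T_l. By rationality z is algebraic over k
     modulo P T_l, which forces 1 into P' T_l. Hence J_l lies in every prime
     strictly above P.
   The encoding a x c = c x a is symmetric, so rationality on the left and on the
   right are treated at once. *)

Set Implicit Arguments.
Unset Strict Implicit.
Unset Printing Implicit Defensive.

Import GRing.Theory.
Local Open Scope classical_set_scope.
Local Open Scope ring_scope.
Local Open Scope quotient_scope.

(** * Goldie's theorem for prime rings *)

Section Goldie.
Variable A : pzRingType.
Implicit Types (a b c d r s t u x y z : A) (E K : set A).

Definition prime_ring :=
  forall a b, (forall x, a * x * b = 0) -> a = 0 \/ b = 0.

(** Essentiality tested on principal right ideals only: every nonzero right ideal contains some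
    nonzero uA, so for a right ideal [E] this is the usual notion. *)
Definition essential E :=
  forall u, u <> 0 -> exists t, u * t <> 0 /\ E (u * t).

(* The trace left on a ring by a right noetherian localization at regular
   elements. *)
Definition noetherian_up_to_regular :=
  forall E : nat -> set A, (forall n, is_right_ideal (E n)) ->
    (forall n, E n `<=` E n.+1) ->
  exists N, forall n x, E n x -> exists2 d, @regular_elements A d & E N (x * d).

Lemma chain_le (E : nat -> set A) : (forall n, E n `<=` E n.+1) ->
  forall m n, (m <= n)%N -> E m `<=` E n.
Proof.
move=> sE m n /subnK <-; elim: (n - m)%N => [//|j IH] x /IH.
by rewrite addSn; apply: sE.
Qed.

Lemma right_ideal_sum E (I : Type) (r : seq I) (P : pred I) (F : I -> A) :
  is_right_ideal E -> (forall i, P i -> E (F i)) -> E (\sum_(i <- r | P i) F i).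
Proof. by case=> E0 ED _ EF; elim/big_ind: _. Qed.

Lemma right_annihilator_right_ideal (X : set A) :
  is_right_ideal (right_annihilator X).
Proof.
split=> [x _|x y Hx Hy z Xz|x r Hx z Xz]; first by rewrite mulr0.
  by rewrite mulrDr Hx // Hy // addr0.
by rewrite mulrA Hx // mul0r.
Qed.

(** A regular d can be cancelled from y x d = 0, so annihilator chains stop. In an infinite direct
    sum, the chain of partial sums puts x d, for x in the N-th summand, into the sum of the earlier
    ones; independence kills x d, hence x. *)
Lemma noetherian_up_to_regular_goldie :
  noetherian_up_to_regular -> right_goldie A.
Proof.
move=> noethA; split.
  move=> X sX; have [] := noethA (fun n => right_annihilator (X n)) _ sX.
    by move=> n; apply: right_annihilator_right_ideal.
  move=> N HN; exists N => n leNn; apply/seteqP; split=> x; last first.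
    exact: (chain_le sX leNn).
  move=> /HN[d [_ dreg] Hd] y Xy.
  by apply: dreg; rewrite -mulrA Hd.
case=> B [idB indB].
pose E n : set A := [set x | exists2 b : 'I_n -> A,
  (forall i : 'I_n, B i (b i)) & x = \sum_(i < n) b i].
have B0 n : B n 0 by have [[]] := idB n.
have [] := noethA E.
- move=> n; split.
  + by exists (fun=> 0) => //; rewrite big1.
  + move=> _ _ [b Bb ->] [b' Bb' ->]; exists (fun i => b i + b' i).
      by move=> i; have [[_ BD _] _] := idB i; apply: BD.
    by rewrite big_split.
  + move=> _ r [b Bb ->]; exists (fun i => b i * r).
      by move=> i; have [[_ _ BM] _] := idB i; apply: BM.
    by rewrite mulr_suml.
- move=> n _ [b Bb ->].
  (* The family [b] is extended by 0 at the new last index. *)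
  exists (fun i : 'I_n.+1 => oapp b 0 (insub (i : nat))).
    move=> i; case: insubP => [j _ <-|_] /=; [exact: Bb|exact: B0].
  rewrite big_ord_recr /= insubF ?ltnn //= addr0.
  by apply: eq_bigr => i _; rewrite insubT ?ltn_ord //= => lti; congr b; apply: val_inj.
move=> N HN; have [_] := idB N; apply; apply/seteqP; split; last by move=> _ ->.
move=> x Bx.
have /HN[d [_ dreg] [b Bb Exd]]: E N.+1 x.
  exists (fun i : 'I_N.+1 => if i == N :> nat then x else 0).
    by move=> i; case: eqP => [->|_].
  rewrite big_ord_recr /= eqxx big1 ?add0r // => i _.
  by rewrite ltn_eqF.
apply: dreg; have [[_ BD BM] _] := idB N.
(* The family [b] below N, completed by -x d at N, has sum zero. *)
pose f (i : 'I_N.+1) := oapp b (- (x * d)) (insub (i : nat)).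
have := indB N.+1 f _ _ ord_max; rewrite /f /= insubF ?ltnn //= => H.
apply/eqP; rewrite -oppr_eq0; apply/eqP; apply: H.
  move=> i; case: insubP => [j _ <-|] /=; first exact: Bb.
  rewrite -leqNgt => leNi.
  have -> : nat_of_ord i = N by apply/eqP; rewrite eqn_leq leNi -ltnS ltn_ord.
  by rewrite -mulrN; apply: BM.
rewrite big_ord_recr /= insubF ?ltnn //= Exd; apply/eqP; rewrite subr_eq0; apply/eqP.
by apply: eq_bigr => i _; rewrite insubT ?ltn_ord //= => lti; congr b; apply: val_inj.
Qed.

Hypothesis accA : acc_right_annihilators A.

Lemma exists_maximal_annihilator (X : set A) : X !=set0 ->
  exists2 a, X a & forall b, X b -> (forall r, a * r = 0 -> b * r = 0) ->
    forall r, b * r = 0 -> a * r = 0.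
Proof.
case=> x0 Xx0; apply: contrapT => noMax.
(* The premise sits under the existential so that [choice] gives a function on the whole ring;
   iterated from [x0], it produces a strictly ascending chain of annihilators. *)
have step a : exists b, X a -> [/\ X b, forall r, a * r = 0 -> b * r = 0 &
    exists r, b * r = 0 /\ a * r <> 0].
  have [Xa|nXa] := pselect (X a); last by exists 0.
  apply: contrapT => Hb; apply: noMax; exists a => // b Xb sab r br0.
  apply: contrapT => ar0; apply: Hb; exists b => _; split=> //.
  by exists r.
have {noMax step} [g gP] := choice step.
pose v n := iter n g x0.
have Xv n : X (v n) by elim: n => [//|n /gP[]].
have [|N HN] := accA (X := fun n => [set v n]).
  by move=> n r vr y ->; have [_ H _] := gP _ (Xv n); apply: H; apply: vr.
have [_ _ [r [br ar]]] := gP _ (Xv N).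
apply: ar; have : right_annihilator [set v N.+1] r by move=> y ->.
by rewrite HN // => /(_ _ erefl).
Qed.

Hypothesis primeA : prime_ring.

(** Take b nonzero in [L] with maximal right annihilator. The last nonzero power of x b is
    annihilated by whatever annihilates b, so by maximality both have the same annihilator, which
    contains x b. Thus b x b = 0 for all x, against primeness. *)
Lemma nil_left_stable_eq0 (L : set A) :
  (forall x y, L y -> L (x * y)) -> nil_set L -> forall a, L a -> a = 0.
Proof.
move=> LM nilL a La; apply: contrapT => a0.
have [|b [Lb b0] maxb] := @exists_maximal_annihilator [set x | L x /\ x <> 0].
  by exists a.
suff: b = 0 \/ b = 0 by case.
apply: primeA => x.
have [n] := nilL _ (LM x b Lb).
elim: n => [|n IHn] xbn.
  by rewrite -[b]mulr1 -(expr0 (x * b)) xbn mulr0 mulr0.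
have [/IHn//|xbn0] := pselect ((x * b) ^+ n = 0).
have [n0|n_gt0] := posnP n.
  by move: xbn; rewrite n0 expr1 -mulrA => ->; rewrite mulr0.
have Lxbn : L ((x * b) ^+ n).
  by rewrite -(prednK n_gt0) exprSr mulrA; apply: LM.
rewrite -mulrA; apply: (maxb _ (conj Lxbn xbn0)); last by rewrite -exprSr.
by move=> r br; rewrite -(prednK n_gt0) exprSr -!mulrA br !mulr0.
Qed.

(** Since (x a)^(n+1) = x (a x)^n a, the left ideal Aa is nil as soon as aA is. *)
Lemma nil_right_stable_eq0 E :
  (forall x y, E x -> E (x * y)) -> nil_set E -> forall a, E a -> a = 0.
Proof.
move=> EM nilE a Ea.
apply: (@nil_left_stable_eq0 [set y | exists x, y = x * a]).
- by move=> x _ [y ->]; exists (x * y); rewrite mulrA.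
- move=> _ [x ->]; have [n axn] := nilE _ (EM a x Ea); exists n.+1.
  have -> : (x * a) ^+ n.+1 = x * (a * x) ^+ n * a.
    elim: {axn} n => [|n IHn]; first by rewrite expr1 expr0 mulr1.
    by rewrite exprSr IHn exprSr !mulrA.
  by rewrite axn mulr0 mul0r.
- by exists 1; rewrite mul1r.
Qed.

Lemma essential_preimage E y :
  E 0 -> essential E -> essential [set r | E (y * r)].
Proof.
move=> E0 essE u u0; have [yu|yu] := pselect (y * u = 0).
  by exists 1; rewrite /= mulr1 yu.
have [t [yut Et]] := essE _ yu; exists t; rewrite /= mulrA; split=> // ut.
by apply: yut; rewrite -mulrA ut mulr0.
Qed.

(* The right singular ideal vanishes. *)
Lemma essential_annihilator_eq0 x : essential [set r | x * r = 0] -> x = 0.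
Proof.
move=> essx; apply: contrapT => x0.
have [|{essx x0}x [essx x0] maxx] := @exists_maximal_annihilator
    [set x | essential [set r | x * r = 0] /\ x <> 0].
  by exists x.
suff: x = 0 \/ x = 0 by case.
(* If x y x were nonzero, essentiality would give t with x t nonzero and x y x t = 0; but x y x and
   x have the same right annihilator by maximality. *)
apply: primeA => y; apply: contrapT => xyx0.
have [t [xt]] := @essential_preimage _ y (mulr0 x) essx _ x0.
rewrite /= !mulrA => xyxt; apply: xt; apply: (maxx (x * y * x)) => //; last first.
  by move=> r xr; rewrite -mulrA xr mulr0.
split=> // u /essx[s [us xus]]; exists s; split=> //=.
by rewrite -mulrA xus mulr0.
Qed.

Hypothesis nosumA : no_infinite_direct_sum A.

Lemma principal_right_ideal a : is_right_ideal [set a * r | r in setT].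
Proof.
split; first by exists 0; rewrite ?mulr0.
  by move=> _ _ [r _ <-] [s _ <-]; exists (r + s); rewrite ?mulrDr.
by move=> _ s [r _ <-]; exists (r * s); rewrite ?mulrA.
Qed.

Lemma no_independent_sequence (v : nat -> A) : (forall n, v n <> 0) ->
  ~ forall n (r : 'I_n -> A), \sum_(i < n) v i * r i = 0 ->
      forall i : 'I_n, v i * r i = 0.
Proof.
move=> v0 indv; apply: nosumA; exists (fun n => [set v n * r | r in setT]); split.
  move=> n; split; first exact: principal_right_ideal.
  move=> vn0; apply: (v0 n); have : [set v n * r | r in setT] (v n).
    by exists 1; rewrite ?mulr1.
  by rewrite vn0.
move=> n x vx sumx0.
have /choice[r rP] (i : 'I_n) : exists r, x i = v i * r.
  by have [r _ <-] := vx i; exists r.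
move=> i; rewrite rP; apply: indv.
by rewrite -[RHS]sumx0; apply: eq_bigr => j _; rewrite rP.
Qed.

(** If [E] is nil, it is 0. Otherwise, among the powers of a non-nilpotent element of [E], one whose
    annihilator is maximal has the same annihilator as its square. *)
Lemma exists_annihilator_stable E : is_right_ideal E ->
  exists a, [/\ E a, (forall r, a * a * r = 0 -> a * r = 0) &
    a = 0 -> E = [set 0]].
Proof.
move=> [E0 _ EM]; have [nilE|] := pselect (nil_set E).
  exists 0; split=> // [r _|_]; first by rewrite mul0r.
  apply/seteqP; split=> [x|_ ->//].
  exact: (nil_right_stable_eq0 EM nilE).
move=> /existsNP[a /not_implyP[Ea /forallNP nila]].
have [|_ [m _ <-] maxm] := @exists_maximal_annihilator [set a ^+ m.+1 | m in setT].
  by exists (a ^+ 1); exists 0%N.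
exists (a ^+ m.+1); split=> [|r|am0]; last by case: (nila m.+1).
  by rewrite exprS; apply: EM.
rewrite -exprD addSn; apply: maxm; first by exists (m + m.+1)%N.
by move=> s as0; rewrite -addSn exprD -mulrA as0 mulr0.
Qed.

(** Start from K_0 = E, pick v_n in K_n with ann(v_n^2) = ann(v_n), and let K_(n+1) be the part of
    K_n annihilated by v_n. The sum of the v_n A is direct, so some v_n, and with it K_n, is 0; then
    c = v_0 + ... + v_(n-1) is left regular. *)
Lemma essential_right_ideal_lreg E : is_right_ideal E -> essential E ->
  exists2 c, E c & forall r, c * r = 0 -> r = 0.
Proof.
move=> idE essE.
have /choice[g gP] (K : set A) : exists a, is_right_ideal K ->
    [/\ K a, (forall r, a * a * r = 0 -> a * r = 0) & a = 0 -> K = [set 0]].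
  have [idK|nidK] := pselect (is_right_ideal K); last by exists 0.
  by have [a aP] := exists_annihilator_stable idK; exists a.
pose K n := iter n (fun K => K `&` right_annihilator [set g K]) E.
have idK n : is_right_ideal (K n).
  elim: n => // n [K0 KD KM].
  have [R0 RD RM] := right_annihilator_right_ideal [set g (K n)].
  split; first by split.
  - by move=> x y [Kx Rx] [Ky Ry]; split; [apply: KD|apply: RD].
  - by move=> x r [Kx Rx]; split; [apply: KM|apply: RM].
pose v n := g (K n).
have Kv n : K n (v n) by have [] := gP _ (idK n).
have vreg n r : v n * v n * r = 0 -> v n * r = 0.
  by have [_ + _] := gP _ (idK n); apply.
have sK m n : (m <= n)%N -> K n `<=` K m.
  move=> /subnK <-; elim: (n - m)%N => // j IH x.
  by rewrite addSn => -[/IH].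
have vv i j : (i < j)%N -> v i * v j = 0.
  by move=> /sK/(_ _ (Kv j))[_]; apply.
(* Multiplying by v_i on the left kills the later terms, induction kills the earlier ones, and
   stability turns v_i v_i r_i = 0 into v_i r_i = 0. *)
have indv n (r : 'I_n -> A) : \sum_(i < n) v i * r i = 0 ->
    forall i : 'I_n, v i * r i = 0.
  move=> sum0 i; have [m] := ubnP (i : nat); elim: m i => // m IHm i lei.
  apply: vreg; rewrite -mulrA.
  have := congr1 ( *%R (v i)) sum0.
  rewrite mulr0 mulr_sumr (bigD1 i) //= big1 ?addr0 // => j neqji.
  have [ltji|ltij|eqij] := ltngtP (j : nat) (i : nat).
  - by rewrite IHm ?mulr0 // (leq_trans ltji).
  - by rewrite mulrA vv ?mul0r.
  - by rewrite (val_inj eqij) eqxx in neqji.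
have [n vn0] : exists n, v n = 0.
  apply: contrapT => /forallNP vn0; exact: (no_independent_sequence vn0).
have Kn0 : K n = [set 0] by have [_ _ ->] := gP _ (idK n).
have [_ _ EM] := idE.
exists (\sum_(i < n) v i).
  by apply: right_ideal_sum => // i _; exact: (sK 0%N i (leq0n i) (v i) (Kv i)).
move=> r /eqP; rewrite mulr_suml => /eqP sum0; apply: contrapT => r0.
have vr := indv n (fun=> r) sum0.
have [t [rt Ert]] := essE _ r0; apply: rt.
(* All v_i with i < n annihilate r, so r t, which is in [E], survives every intersection defining
   K_n. *)
suff: K n (r * t) by rewrite Kn0.
elim: {Kn0 vn0 sum0} n vr => // n IHn vr; split.
  by apply: IHn => i; have := vr (widen_ord (leqnSn n) i).
by move=> _ ->; rewrite mulrA (vr ord_max) mul0r.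
Qed.

(** If cA met uA only in 0, the right ideals c^n u A would be independent: in a relation the term u
    r_0 lies in cA, so it vanishes, and c cancels from the rest. *)
Lemma lreg_essential c : (forall r, c * r = 0 -> r = 0) ->
  essential [set c * r | r in setT].
Proof.
move=> creg u u0; apply: contrapT => Hu.
have cu t s : u * t = c * s -> u * t = 0.
  move=> ut; apply: contrapT => ut0; apply: Hu; exists t; split=> //.
  by exists s.
have cn n r : c ^+ n * r = 0 -> r = 0.
  elim: n r => [|n IHn] r; first by rewrite expr0 mul1r.
  by rewrite exprSr -mulrA => /IHn; apply: creg.
apply: (@no_independent_sequence (fun n => c ^+ n * u)).
  by move=> n /cn.
elim=> [|n IHn] r; first by move=> _ [].
rewrite big_ord_recl expr0 mul1r.
under eq_bigr do rewrite lift0 exprS -2!mulrA.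
rewrite -mulr_sumr => sum0.
have ur : u * r ord0 = 0.
  by apply: (@cu _ (- \sum_(i < n) c ^+ i * (u * r (lift ord0 i))));
     rewrite mulrN; apply/eqP; rewrite -addr_eq0; apply/eqP.
move: sum0; rewrite ur add0r => /creg sum0 i.
case: (unliftP ord0 i) => [j ->|->]; last by rewrite expr0 mul1r.
rewrite lift0 exprS -2!(mulrA c).
rewrite (IHn (fun j => r (lift ord0 j))) ?mulr0 //.
by rewrite -[RHS]sum0; apply: eq_bigr => l _; rewrite mulrA.
Qed.

(** If x c = 0, then x annihilates the essential right ideal cA, so x is singular and hence 0. *)
Lemma lreg_regular c : (forall r, c * r = 0 -> r = 0) -> @regular_elements A c.
Proof.
move=> creg; split=> // x xc; apply: essential_annihilator_eq0 => u u0.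
have [t [ut [s _ cs]]] := lreg_essential creg u0.
by exists t; split=> //=; rewrite -cs mulrA xc mul0r.
Qed.

(** For the Ore condition, the right ideal of all x with s x in dA is essential because dA is, so it
    contains a regular element. *)
Theorem goldie : right_denominator_set (@regular_elements A).
Proof.
split=> //; split=> [|d e [ld rd] [le re]|s d [ld rd]].
- by split=> x; rewrite ?mul1r ?mulr1.
- by split=> x; [rewrite -mulrA => /ld/le|rewrite mulrA => /re/rd].
pose dA := [set d * r | r in setT].
have [dA0 dAD dAM] := principal_right_ideal d.
have [||c [r _ dr] creg] := @essential_right_ideal_lreg [set x | dA (s * x)].
- split=> [|x y|x r]; rewrite /= ?mulr0 ?mulrDr ?mulrA //; [exact: dAD|exact: dAM].
- by apply: essential_preimage => //; apply: lreg_essential.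
by exists r, c; split; [exact: lreg_regular|rewrite dr].
Qed.

End Goldie.

(** * Right Ore localization *)

(* The localization is realized as the ring of germs of right linear maps from
   right ideals meeting D to A. The fraction s/d is the germ of d x |-> s x. *)
Section Localization.
Variables (A : pzRingType) (D : set A).
Hypothesis denD : right_denominator_set D.

Record partial_map := PartialMap {
  dom : set A;
  fn : A -> A;
  dom_ideal : is_right_ideal dom;
  dom_denom : exists2 d, D d & dom d;
  fnD : forall x y, dom x -> dom y -> fn (x + y) = fn x + fn y;
  fnM : forall x r, dom x -> fn (x * r) = fn x * r }.

HB.instance Definition _ := gen_eqMixin partial_map.
HB.instance Definition _ := gen_choiceMixin partial_map.

Implicit Types f g h : partial_map.

(** Agreement at a single d in [D] suffices: by linearity it extends to dA. *)
Definition germ_eq f g := `[< exists d, [/\ D d, dom f d, dom g d & fn f d = fn g d] >].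

Let D1 : D 1. Proof. by have [[]] := denD. Qed.
Let DM d e : D d -> D e -> D (d * e).
Proof. by have [[_ H _] _] := denD; apply: H. Qed.
Let ore s d : D d -> exists s' d', D d' /\ s * d' = d * s'.
Proof. by have [[_ _ H] _] := denD; apply: H. Qed.
Let Dlreg d x : D d -> d * x = 0 -> x = 0.
Proof. by have [_ H] := denD => /H[+ _]; apply. Qed.
Let Drreg d x : D d -> x * d = 0 -> x = 0.
Proof. by have [_ H] := denD => /H[_ +]; apply. Qed.

Let domM f x r : dom f x -> dom f (x * r).
Proof. by have [_ _ H] := dom_ideal f; apply: H. Qed.
Let domD f x y : dom f x -> dom f y -> dom f (x + y).
Proof. by have [_ H _] := dom_ideal f; apply: H. Qed.
Let dom0 f : dom f 0.
Proof. by have [H _ _] := dom_ideal f. Qed.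

Lemma common_denom f g : exists d, [/\ D d, dom f d & dom g d].
Proof.
have [d Dd fd] := dom_denom f; have [e De ge] := dom_denom g.
have [s [d' [Dd' eds]]] := ore d De.
by exists (d * d'); split; [exact: DM|exact: domM|rewrite eds; apply: domM].
Qed.

Lemma germ_eqI f g : (forall x, dom f x -> dom g x -> fn f x = fn g x) ->
  germ_eq f g.
Proof.
move=> efg; have [d [Dd fd gd]] := common_denom f g.
by apply/asboolP; exists d; split => //; apply: efg.
Qed.

Lemma germ_eq_equiv : equiv_class_of germ_eq.
Proof.
split=> [f|f g|g f h]; first exact: germ_eqI.
  by apply: asbool_equiv_eq; split=> -[d [? ? ? ?]]; exists d; split.
move=> /asboolP[d [Dd fd gd efg]] /asboolP[e [De ge he egh]]; apply/asboolP.
have [s [d' [Dd' eds]]] := ore d De.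
exists (d * d'); split; [exact: DM|exact: domM|by rewrite eds; apply: domM|].
by rewrite fnM // efg -fnM // eds !fnM // egh.
Qed.

Canonical germ_eq_rel := EquivRelPack germ_eq_equiv.

Definition localization := {eq_quot germ_eq}.
HB.instance Definition _ := Choice.on localization.
HB.instance Definition _ := EqQuotient.on localization.

Definition germ f : localization := \pi_localization f.

Lemma germP f g : reflect (germ f = germ g) (germ_eq f g).
Proof. by apply/(iffP idP) => [/eqmodP//|/eqmodP]. Qed.

Lemma germ_surj (u : localization) : exists f, u = germ f.
Proof. by exists (repr u); rewrite /germ reprK. Qed.

Lemma germ_eq_repr f : germ_eq (repr (germ f)) f.
Proof. by apply/germP; rewrite /germ reprK. Qed.

Fact pf_addP f g :
  [/\ is_right_ideal (dom f `&` dom g),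
      exists2 d, D d & (dom f `&` dom g) d,
      forall x y, (dom f `&` dom g) x -> (dom f `&` dom g) y ->
        fn f (x + y) + fn g (x + y) = (fn f x + fn g x) + (fn f y + fn g y) &
      forall x r, (dom f `&` dom g) x ->
        fn f (x * r) + fn g (x * r) = (fn f x + fn g x) * r].
Proof.
split=> [||x y [fx gx] [fy gy]|x r [fx gx]].
- by split=> [|x y [? ?] [? ?]|x r [? ?]]; split; auto.
- by have [d []] := common_denom f g; exists d.
- by rewrite !fnD // addrACA.
- by rewrite !fnM // mulrDl.
Qed.

Definition pf_add f g : partial_map :=
  let: And4 a b c d := pf_addP f g in PartialMap a b c d.

Fact pf_mulP f g : let E := dom g `&` fn g @^-1` dom f in
  [/\ is_right_ideal E,
      exists2 d, D d & E d,
      forall x y, E x -> E y -> fn f (fn g (x + y)) = fn f (fn g x) + fn f (fn g y) &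
      forall x r, E x -> fn f (fn g (x * r)) = fn f (fn g x) * r].
Proof.
move=> E; split=> [||x y [gx fgx] [gy fgy]|x r [gx fgx]].
- split=> [|x y [gx fgx] [gy fgy]|x r [gx fgx]].
  + by split=> //; rewrite /= -(mulr0 (0 : A)) fnM // mulr0.
  + by split; [exact: domD|rewrite /= fnD //; apply: domD].
  + by split; [exact: domM|rewrite /= fnM //; apply: domM].
- have [d Dd gd] := dom_denom g; have [e De fe] := dom_denom f.
  have [s [d' [Dd' ges]]] := ore (fn g d) De.
  exists (d * d'); first exact: DM.
  by split; [exact: domM|rewrite /= fnM // ges; apply: domM].
- by rewrite !fnD.
- by rewrite !fnM.
Qed.

Definition pf_mul f g : partial_map :=
  let: And4 a b c d := pf_mulP f g in PartialMap a b c d.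

Lemma setT_ideal : is_right_ideal (@setT A). Proof. by []. Qed.
Lemma setT_denom : exists2 d, D d & (@setT A) d. Proof. by exists 1. Qed.

Definition pf_left (a : A) : partial_map :=
  PartialMap setT_ideal setT_denom (fun x y _ _ => mulrDr a x y)
    (fun x r _ => mulrA a x r).

Lemma dom_add f g : dom (pf_add f g) = dom f `&` dom g.
Proof. by rewrite /pf_add; case: pf_addP. Qed.
Lemma fn_add f g x : fn (pf_add f g) x = fn f x + fn g x.
Proof. by rewrite /pf_add; case: pf_addP. Qed.
Lemma dom_mul f g : dom (pf_mul f g) = dom g `&` fn g @^-1` dom f.
Proof. by rewrite /pf_mul; case: pf_mulP. Qed.
Lemma fn_mul f g x : fn (pf_mul f g) x = fn f (fn g x).
Proof. by rewrite /pf_mul; case: pf_mulP. Qed.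

Definition loc_add (u v : localization) := germ (pf_add (repr u) (repr v)).
Definition loc_mul (u v : localization) := germ (pf_mul (repr u) (repr v)).
Definition loc_left (a : A) : localization := germ (pf_left a).
Definition loc_opp (u : localization) := loc_mul (loc_left (-1)) u.

(** Agreement at d passes to s d' = d s'. This makes products well defined, with s a value of the
    inner map. *)
Lemma germ_eq_below f g e s : germ_eq f g -> D e ->
  exists d', [/\ D d', dom f (s * d'), dom g (s * d') & fn f (s * d') = fn g (s * d')].
Proof.
move=> /asboolP[d [Dd fd gd efg]] De; have [s' [d' [Dd' eds]]] := ore s Dd.
by exists d'; rewrite eds; split=> //; [exact: domM|exact: domM|rewrite !fnM // efg].
Qed.

Lemma germD f g : loc_add (germ f) (germ g) = germ (pf_add f g).
Proof.
apply/germP/asboolP; have /asboolP[d [Dd fd fd' efd]] := germ_eq_repr f.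
have [d' [Dd' gd gd' egd]] := germ_eq_below d (germ_eq_repr g) Dd.
have e1 : fn (repr (germ f)) (d * d') = fn f (d * d') by rewrite !fnM // efd.
exists (d * d'); rewrite !dom_add !fn_add egd e1.
by split=> //; [exact: DM|split=> //; apply: domM|split=> //; apply: domM].
Qed.

Lemma germM f g : loc_mul (germ f) (germ g) = germ (pf_mul f g).
Proof.
apply/germP/asboolP; have /asboolP[d [Dd gd gd' egd]] := germ_eq_repr g.
have [d' [Dd' fd fd' efd]] := germ_eq_below (fn g d) (germ_eq_repr f) Dd.
exists (d * d'); rewrite !dom_mul !fn_mul.
have e1 : fn (repr (germ g)) (d * d') = fn g d * d' by rewrite fnM // egd.
have e2 : fn g (d * d') = fn g d * d' by rewrite fnM.
split; rewrite ?e1 ?e2 //; first exact: DM.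
- by split; [exact: domM|rewrite /= e1].
- by split; [exact: domM|rewrite /= e2].
Qed.

(** Reduces a ring axiom to a pointwise identity between representatives on their common domain. *)
Local Ltac germs :=
  repeat (let f := fresh "f" in move=> /germ_surj[f ->]);
  rewrite /loc_opp /loc_left ?(germD, germM); apply/germP; apply: germ_eqI => x;
  rewrite ?(dom_add, dom_mul, fn_add, fn_mul) /=.

Fact loc_addA : associative loc_add.
Proof. by move=> u v w; move: u v w; germs; rewrite ?fn_add addrA. Qed.
Fact loc_addC : commutative loc_add.
Proof. by germs; rewrite addrC. Qed.
Fact loc_add0 : left_id (loc_left 0) loc_add.
Proof. by germs; rewrite mul0r add0r. Qed.
Fact loc_addN : left_inverse (loc_left 0) loc_opp loc_add.
Proof. by germs; rewrite mulN1r addNr mul0r. Qed.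
Fact loc_mulA : associative loc_mul.
Proof. by germs. Qed.
Fact loc_mul1 : left_id (loc_left 1) loc_mul.
Proof. by germs; rewrite mul1r. Qed.
Fact loc_mulr1 : right_id (loc_left 1) loc_mul.
Proof. by germs; rewrite mul1r. Qed.
Fact loc_mulDl : left_distributive loc_mul loc_add.
Proof. by germs. Qed.
Fact loc_mulDr : right_distributive loc_mul loc_add.
Proof. by germs => -[[_ _] _] [[_ ?] [_ ?]]; rewrite fnD. Qed.

HB.instance Definition _ := GRing.isZmodule.Build localization
  loc_addA loc_addC loc_add0 loc_addN.
HB.instance Definition _ := GRing.Zmodule_isPzRing.Build localization
  loc_mulA loc_mul1 loc_mulr1 loc_mulDl loc_mulDr.

Fact loc_left_zmod_morphism : zmod_morphism loc_left.
Proof.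
move=> a b; rewrite -[RHS]/(loc_add (loc_left a) (loc_opp (loc_left b))).
by germs; rewrite mulrBl mulN1r.
Qed.
Fact loc_left_monoid_morphism : monoid_morphism loc_left.
Proof.
split=> // a b; rewrite -[RHS]/(loc_mul (loc_left a) (loc_left b)).
by germs; rewrite mulrA.
Qed.
HB.instance Definition _ := GRing.isZmodMorphism.Build A localization
  loc_left loc_left_zmod_morphism.
HB.instance Definition _ := GRing.isMonoidMorphism.Build A localization
  loc_left loc_left_monoid_morphism.

(** The map d r |-> r, well defined because d is left regular; its germ is 1/d. *)
Fact pf_invP (d : A) : D d -> exists f,
  dom f = [set d * r | r in setT] /\ forall r, fn f (d * r) = r.
Proof.
move=> Dd.
have dI x y : d * x = d * y -> x = y.
  by move=> /eqP; rewrite -subr_eq0 -mulrBr => /eqP/(Dlreg Dd)/eqP; rewrite subr_eq0 => /eqP.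
have /choice[g gP] (x : A) : exists y, (exists r, x = d * r) -> x = d * y.
  by have [[r ->]|nx] := pselect (exists r, x = d * r); [exists r|exists 0].
have gd r : g (d * r) = r by apply/esym/dI/gP; exists r.
unshelve eexists (@PartialMap [set d * r | r in setT] g _ _ _ _) => //.
- split; first by exists 0; rewrite ?mulr0.
    by move=> _ _ [r _ <-] [s _ <-]; exists (r + s); rewrite ?mulrDr.
  by move=> _ s [r _ <-]; exists (r * s); rewrite ?mulrA.
- by exists d => //; exists 1; rewrite ?mulr1.
- by move=> _ _ [r _ <-] [s _ <-]; rewrite -mulrDr !gd.
- by move=> _ s [r _ <-]; rewrite -mulrA !gd.
Qed.

Lemma loc_left_localization : right_localization D loc_left.
Proof.
split.
- move=> a b /germP/asboolP[d [Dd _ _ /= ead]]; apply/eqP; rewrite -subr_eq0.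
  by apply/eqP/(Drreg Dd); rewrite mulrBl ead subrr.
- move=> d Dd; have [f [fdom fd]] := pf_invP Dd.
  exists (germ f); split.
    rewrite -[LHS]/(loc_mul _ _) -[RHS]/(loc_left 1); germs => _ _.
    by rewrite fd mul1r.
  rewrite -[LHS]/(loc_mul _ _) -[RHS]/(loc_left 1); germs.
  by rewrite fdom mul1r => -[[r _ <-] _] _; rewrite fd.
- move=> u; have [f ->] := germ_surj u; have [d Dd fd] := dom_denom f.
  exists (fn f d), d; split=> //; rewrite -[LHS]/(loc_mul _ _); germs => _ _.
  by rewrite fnM.
Qed.

End Localization.

Theorem ore_localization (A : pzRingType) (D : set A) :
  right_denominator_set D ->
  exists (Q : pzRingType) (phi : {rmorphism A -> Q}), right_localization D phi.
Proof.
by move=> denD; exists (localization denD), (loc_left denD); apply: loc_left_localization.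
Qed.

(** * Prime ideals and fractions *)

Section PrimeIdeals.
Variable R : pzRingType.
Implicit Types (I P : ideal R) (a b r x y : R).

Lemma ideal0 I : ideal_set I 0. Proof. by have [] := idealP I. Qed.
Lemma idealD I x y : ideal_set I x -> ideal_set I y -> ideal_set I (x + y).
Proof. by have [_ H _ _] := idealP I; apply: H. Qed.
Lemma ideal_mull I r x : ideal_set I x -> ideal_set I (r * x).
Proof. by have [_ _ H _] := idealP I; apply: H. Qed.
Lemma ideal_mulr I x r : ideal_set I x -> ideal_set I (x * r).
Proof. by have [_ _ _ H] := idealP I; apply: H. Qed.
Lemma idealN I x : ideal_set I x -> ideal_set I (- x).
Proof. by rewrite -mulN1r; apply: ideal_mull. Qed.
Lemma idealB I x y : ideal_set I x -> ideal_set I y -> ideal_set I (x - y).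
Proof. by move=> Ix /idealN; apply: idealD. Qed.
Lemma ideal_subl I x y : ideal_set I (x - y) -> ideal_set I y -> ideal_set I x.
Proof. by move=> Ixy Iy; rewrite -[x](subrK y); apply: idealD. Qed.

Lemma factor_proj0 I x : factor_proj I x = 0 <-> ideal_set I x.
Proof. by rewrite -(rmorph0 (factor_proj I)) factor_proj_eq subr0. Qed.

Lemma prime_ideal_neq1 P : prime_ideal P -> ~ ideal_set P 1.
Proof. by move=> [[x nPx] _] P1; apply: nPx; rewrite -[x]mulr1; apply: ideal_mull. Qed.

(** Primeness is applied to the ideal of all u with u R b inside P, and to the ideal of all v such
    that u R v is inside P for each such u. *)
Lemma prime_ideal_mul P a b : prime_ideal P ->
  (forall x, ideal_set P (a * x * b)) -> ideal_set P a \/ ideal_set P b.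
Proof.
move=> [_ primeP] Pab.
have idA : is_ideal [set u | forall x, ideal_set P (u * x * b)].
  split=> [x|u v Pu Pv x|r u Pu x|u r Pu x].
  - by rewrite !mul0r; apply: ideal0.
  - by rewrite !mulrDl; apply: idealD.
  - by rewrite -!mulrA; apply: ideal_mull; rewrite mulrA.
  - by rewrite -(mulrA u).
have idB : is_ideal [set v | forall u, (forall x, ideal_set P (u * x * b)) ->
    forall x, ideal_set P (u * x * v)].
  split=> [u _ x|v w Pv Pw u Pu x|r v Pv u Pu x|v r Pv u Pu x].
  - by rewrite mulr0; apply: ideal0.
  - by rewrite mulrDr; apply: idealD; [apply: Pv|apply: Pw].
  - by rewrite mulrA -(mulrA u); apply: Pv.
  - by rewrite mulrA; apply/ideal_mulr/Pv.
have [|sA|sB] := primeP (Ideal idA) (Ideal idB).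
- move=> _ [n [u [v [uv ->]]]]; elim/big_ind: _ => [|x y|i _].
  + exact: ideal0.
  + exact: idealD.
  + by have [Pu Pv] := uv i; have := Pv _ Pu 1; rewrite mulr1.
- by left; apply: sA.
- by right; apply: sB => u; apply.
Qed.

Lemma factor_prime_ring P : prime_ideal P -> prime_ring (factor_ring P).
Proof.
move=> primeP u v; have [a <-] := factor_proj_surj u.
have [b <-] := factor_proj_surj v => Hab.
have [x|Pa|Pb] := @prime_ideal_mul P a b primeP.
- by apply/factor_proj0; rewrite !rmorphM; apply: Hab.
- by left; apply/factor_proj0.
- by right; apply/factor_proj0.
Qed.

Lemma factor_regular P c : regular_mod P c ->
  @regular_elements (factor_ring P) (factor_proj P c).
Proof.
move=> [lc rc]; split=> u; have [x <-] := factor_proj_surj u;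
  rewrite -rmorphM => /factor_proj0 Pcx; apply/factor_proj0; [exact: lc|exact: rc].
Qed.

Lemma regular_factor P c :
  @regular_elements (factor_ring P) (factor_proj P c) -> regular_mod P c.
Proof.
move=> [lc rc]; split=> x /factor_proj0; rewrite rmorphM => H; apply/factor_proj0;
  [exact: lc|exact: rc].
Qed.

Fact image_is_ideal I P : is_ideal [set s | exists2 r, ideal_set P r & factor_proj I r = s].
Proof.
split.
- by exists 0; [exact: ideal0|rewrite rmorph0].
- move=> _ _ [r Pr <-] [s Ps <-]; exists (r + s); [exact: idealD|by rewrite rmorphD].
- move=> u _ [r Pr <-]; have [x <-] := factor_proj_surj u.
  by exists (x * r); [exact: ideal_mull|rewrite rmorphM].
- move=> _ u [r Pr <-]; have [x <-] := factor_proj_surj u.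
  by exists (r * x); [exact: ideal_mulr|rewrite rmorphM].
Qed.

Definition image_ideal I P : ideal (factor_ring I) := Ideal (image_is_ideal I P).

Lemma image_idealE I P r : I `<=` P ->
  ideal_set (image_ideal I P) (factor_proj I r) <-> ideal_set P r.
Proof.
move=> sIP; split=> [[s Ps /esym/factor_proj_eq/sIP Prs]|Pr]; last by exists r.
exact: ideal_subl Prs Ps.
Qed.

Lemma image_ideal_prime I P : I `<=` P -> prime_ideal P -> prime_ideal (image_ideal I P).
Proof.
move=> sIP [[x nPx] primeP]; split.
  by exists (factor_proj I x) => /(image_idealE _ sIP).
move=> A B sAB.
have id_preim (C : ideal (factor_ring I)) : is_ideal (factor_proj I @^-1` C).
  split=> [|a b|r a|a r]; rewrite /= ?(rmorph0, rmorphD, rmorphM).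
  - by have [] := idealP C.
  - by have [_ H _ _] := idealP C; apply: H.
  - by have [_ _ H _] := idealP C; apply: H.
  - by have [_ _ _ H] := idealP C; apply: H.
have [|sA|sB] := primeP (Ideal (id_preim A)) (Ideal (id_preim B)).
- move=> _ [n [a [b [ab ->]]]]; apply/(image_idealE _ sIP); apply: sAB.
  exists n, (fun i => factor_proj I (a i)), (fun i => factor_proj I (b i)).
  split; first exact: ab.
  by rewrite rmorph_sum; apply: eq_bigr => i _; rewrite rmorphM.
- left=> u; have [a <-] := factor_proj_surj u => Aa.
  by apply/(image_idealE _ sIP)/sA.
- right=> u; have [a <-] := factor_proj_surj u => Ba.
  by apply/(image_idealE _ sIP)/sB.
Qed.

Lemma image_ideal_regular I P c : I `<=` P ->
  regular_mod (image_ideal I P) (factor_proj I c) -> regular_mod P c.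
Proof.
by move=> sIP [lc rc]; split=> x Px; apply/(image_idealE _ sIP);
  [apply: lc|apply: rc]; rewrite -rmorphM; apply/(image_idealE _ sIP).
Qed.

Lemma regular_mod_exp P c n : regular_mod P c -> ideal_set P (c ^+ n) -> ideal_set P 1.
Proof.
move=> [lc _]; elim: n => [|n IHn]; first by rewrite expr0.
by rewrite exprS => /lc.
Qed.

End PrimeIdeals.

Lemma expr_right_inverse (R : pzRingType) (x y : R) n :
  x * y = 1 -> x ^+ n * y ^+ n = 1.
Proof.
move=> xy1; elim: n => [|n IHn]; first by rewrite mulr1.
by rewrite exprSr exprS mulrA -(mulrA _ x) xy1 mulr1.
Qed.

(** * Extension and contraction of right ideals along a localization *)

Section Fractions.
Variables (S T : pzRingType) (D : set S) (phi : {rmorphism S -> T}).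
Hypotheses (denD : right_denominator_set D) (locT : right_localization D phi).

(** For a right ideal [E], this is the extended right ideal E T. *)
Definition fractions (E : set S) : set T :=
  [set q | exists s d, [/\ E s, D d & q * phi d = phi s]].

Lemma fractions_right_ideal E : is_right_ideal E -> is_right_ideal (fractions E).
Proof.
have [[D1 DM ore] _] := denD; have [_ _ frac] := locT.
move=> [E0 ED EM]; split.
- by exists 0, 1; rewrite mul0r rmorph0.
- move=> q q' [s [d [Es Dd qd]]] [s' [d' [Es' Dd' qd']]].
  have [x [e [De eq_de]]] := ore d d' Dd'.
  exists (s * e + s' * x), (d * e); split; first by apply: ED; apply: EM.
    exact: DM.
  rewrite mulrDl {2}eq_de !rmorphM rmorphD !rmorphM !mulrA qd qd'.
  by [].
- move=> q t [s [d [Es Dd qd]]]; have [x [e [De te]]] := frac t.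
  have [y [f [Df eq_xf]]] := ore x d Dd.
  exists (s * y), (e * f); split; [exact: EM|exact: DM|].
  by rewrite rmorphM -mulrA (mulrA t) te -rmorphM eq_xf rmorphM mulrA qd rmorphM.
Qed.

Lemma sub_fractions (E : set S) s : E s -> fractions E (phi s).
Proof. by have [[D1 _ _] _] := denD; exists s, 1; rewrite rmorph1 mulr1. Qed.

Lemma fractionsS (E F : set S) : E `<=` F -> fractions E `<=` fractions F.
Proof. by move=> sEF q [s [d [/sEF ? ? ?]]]; exists s, d. Qed.

Lemma fractions_contract (N : ideal S) s :
  (forall d, D d -> regular_mod N d) -> fractions N (phi s) -> ideal_set N s.
Proof.
move=> regD [s' [d [Ns' Dd]]]; have [phi_inj _ _] := locT.
by rewrite -rmorphM => /phi_inj sd; have [_] := regD _ Dd; apply; rewrite sd.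
Qed.

Lemma ideal_right_ideal (N : ideal S) : is_right_ideal N.
Proof. by have [] := idealP N. Qed.

(* Stationarity of the chain d^-n N T makes N T stable under d^-1. *)
Lemma fractions_ideal (N : ideal S) : right_noetherian T -> is_ideal (fractions N).
Proof.
move=> noethT; have [F0 FD FM] := fractions_right_ideal (ideal_right_ideal N).
have [_ inv frac] := locT.
have FphiM x q : fractions N q -> fractions N (phi x * q).
  move=> [s [d [Ns Dd qd]]]; exists (x * s), d; split=> //; first exact: ideal_mull.
  by rewrite -mulrA qd rmorphM.
split=> // t q Fq.
have [s [d [Dd td]]] := frac t; have [v [vd dv]] := inv d Dd.
have -> : t = phi s * v by rewrite -td -mulrA dv mulr1.
rewrite -mulrA; apply: (FphiM).
have [||m Hm] := noethT (fun n => [set q | fractions N (phi d ^+ n * q)]).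
- move=> n; split=> [|x y|x r]; rewrite /= ?mulr0 ?mulrDr ?mulrA //; [exact: FD|exact: FM].
- by move=> n x; rewrite /= exprS -mulrA; apply: (FphiM).
have dvn n := expr_right_inverse n dv.
(* Compare the terms m+1 and m at v^(m+1) q: the first condition says that q is in N T, the second
   that v q is. *)
have := Hm m.+1 (leqnSn m).
move=> /(congr1 (fun X : set T => X (v ^+ m * (v * q)))) /=.
rewrite exprS -!mulrA !(mulrA (phi d ^+ m)) dvn mul1r => <-.
by rewrite (mulrA (phi d)) dv mul1r.
Qed.

End Fractions.

(** A chain in R / P is pulled back to R, mapped to R / I and extended to [T], where it stops;
    clearing denominators costs a factor from [D], which is regular modulo P. *)
Lemma factor_noetherian_up_to_regular (R : pzRingType) (I P : ideal R)
    (D : set (factor_ring I)) (T : pzRingType) (phi : {rmorphism factor_ring I -> T}) :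
  right_denominator_set D -> right_localization D phi -> right_noetherian T ->
  I `<=` P -> (forall d, D d -> regular_mod (image_ideal I P) d) ->
  noetherian_up_to_regular (factor_ring P).
Proof.
move=> denD locT noethT sIP regD E idE sE.
pose E' n := [set s | exists2 r, E n (factor_proj P r) & factor_proj I r = s].
have idE' n : is_right_ideal (E' n).
  have [E0 ED EM] := idE n; split.
  - by exists 0; rewrite rmorph0.
  - move=> _ _ [r Er <-] [s Es <-]; exists (r + s); rewrite ?rmorphD //; exact: ED.
  - move=> _ u [r Er <-]; have [x <-] := factor_proj_surj u.
    by exists (r * x); rewrite ?rmorphM //; apply: EM.
have [||N HN] := noethT (fun n => fractions D phi (E' n)).
- by move=> n; apply: fractions_right_ideal.
- by move=> n; apply: fractionsS => s [r /sE Er <-]; exists r.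
exists N => n u; have [r <-] := factor_proj_surj u => Er.
(* The index n + N is above both n and the stationary index N. *)
have : fractions D phi (E' (n + N)%N) (phi (factor_proj I r)).
  apply: sub_fractions => //; exists r => //.
  by apply: (chain_le sE) Er; apply: leq_addr.
rewrite HN ?leq_addl // => -[_ [d [[r' Er' <-] Dd]]].
have [phi_inj _ _] := locT; rewrite -rmorphM => /phi_inj.
move: Dd; have [c <-] := factor_proj_surj d => Dc.
rewrite -rmorphM => /factor_proj_eq/sIP/factor_proj_eq Erc.
exists (factor_proj P c); last first.
  by have -> : factor_proj P r * factor_proj P c = factor_proj P r' by rewrite -rmorphM /=.
exact/factor_regular/(image_ideal_regular sIP)/regD.
Qed.

(** * Central fractions *)

Section Centroid.
Variable k : fieldType.

(* The pairs (a, c) are the fractions a / c central in the quotient ring, and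
   the sum is p(a / c) c^(size p). *)
Definition algebraic_centroid (A : pzRingType) (iota : k -> A) :=
  forall a c, @regular_elements A c -> (forall x, a * x * c = c * x * a) ->
  exists2 p : {poly k}, p != 0 &
    \sum_(i < size p) iota p`_i * a ^+ i * c ^+ (size p - i) = 0.

Section Right.
Variables (A : pzRingType) (iota : k -> A).

Lemma fraction_expr (Q : pzRingType) (phi : {rmorphism A -> Q}) (a c : A) (z : Q) n i :
  z * phi c = phi a -> GRing.comm z (phi c) -> (i <= n)%N ->
  z ^+ i * phi c ^+ n = phi (a ^+ i * c ^+ (n - i)).
Proof.
move=> zc comm_zc lein.
by rewrite -{1}(subnKC lein) exprD mulrA -exprMn_comm // zc rmorphM !rmorphXn.
Qed.

Lemma fraction_polynomial (Q : pzRingType) (phi : {rmorphism A -> Q})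
    (p : {poly k}) (a c : A) (z : Q) :
  z * phi c = phi a -> GRing.comm z (phi c) ->
  (\sum_(i < size p) phi (iota p`_i) * z ^+ i) * phi c ^+ size p =
  phi (\sum_(i < size p) iota p`_i * a ^+ i * c ^+ (size p - i)).
Proof.
move=> zc comm_zc; rewrite mulr_suml rmorph_sum; apply: eq_bigr => i _.
by rewrite -mulrA (fraction_expr zc) // 1?ltnW // -rmorphM mulrA.
Qed.

Lemma algebraic_center_centroid :
  right_goldie_algebraic_center iota -> algebraic_centroid iota.
Proof.
move=> [_ [Q [phi [[phi_inj inv frac] algQ]]]] a c creg axc.
have [u [uc cu]] := inv c creg.
(* Multiplying the identity by u = 1/c on both sides gives u a x = x a u; the case x = 1 makes u and
   a commute. *)
have ua : u * phi a = phi a * u.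
  have := congr1 (fun x => u * phi x * u) (axc 1).
  by rewrite !mulr1 !rmorphM !mulrA uc mul1r -!mulrA cu mulr1.
pose z := phi a * u.
have zA x : z * phi x = phi x * z.
  have := congr1 (fun x => u * phi x * u) (axc x).
  rewrite !rmorphM !mulrA uc mul1r -!mulrA cu mulr1 => H.
  by rewrite /z -H !mulrA ua.
have zc : z * phi c = phi a by rewrite /z -mulrA uc mulr1.
have cz : center z.
  move=> q; have [s [d [dreg qd]]] := frac q; have [v [_ dv]] := inv d dreg.
  rewrite -[LHS]mulr1 -dv mulrA -(mulrA z) qd zA -qd.
  by rewrite -(mulrA q) -zA !mulrA -(mulrA _ (phi d)) dv mulr1.
have [p p0 pz] := algQ z cz; exists p => //; apply: phi_inj.
by rewrite rmorph0 -(fraction_polynomial p zc (zA c)) -[X in X * _]/(_) pz mul0r.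
Qed.

Lemma centroid_algebraic_center : prime_ring A -> right_goldie A ->
  algebraic_centroid iota -> right_goldie_algebraic_center iota.
Proof.
move=> primeA goldieA algA; split=> //; have [accA nosumA] := goldieA.
have [Q [phi locQ]] := ore_localization (goldie accA primeA nosumA).
exists Q, phi; split=> // z cz; have [phi_inj inv frac] := locQ.
have [a [c [creg zc]]] := frac z.
have [|p p0 pa] := algA a c creg.
  (* With a = z c and z central, both sides equal z c x c. *)
  move=> x; apply: phi_inj.
  by rewrite !rmorphM -zc -!mulrA cz -!mulrA cz.
exists p => //; have [v [_ cv]] := inv c creg.
have cvn n := expr_right_inverse n cv.
have := fraction_polynomial p zc (cz (phi c)).
by rewrite pa rmorph0 => /(congr1 ( *%R^~ (v ^+ size p))); rewrite -mulrA cvn mulr1 mul0r.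
Qed.

End Right.

(** Reversing products swaps the two sides of a x c = c x a. The terms of the relation are reordered
    using that a and c commute (the case x = 1) and that [iota] is central. *)
Lemma converse_algebraic_centroid (A : pzRingType) (iota : k -> A) :
  central_map iota -> algebraic_centroid (iota : k -> A^c) -> algebraic_centroid iota.
Proof.
move=> ciota algA a c [lc rc] axc.
have comm_ac : GRing.comm a c by have := axc 1; rewrite !mulr1.
have rev_term y n m : iota y * a ^+ n * c ^+ m = c ^+ m * (a ^+ n * iota y).
  have cy : GRing.comm (iota y) (a ^+ n) := ciota y _.
  rewrite [in LHS]cy; have cy' : GRing.comm (iota y) (c ^+ m) := ciota y _.
  by rewrite -mulrA cy' !mulrA; congr (_ * _); apply/commrX/commr_sym/commrX/commr_sym.
have [||p p0 pa] := algA a c.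
- by split.
- by move=> x; have H := axc x; rewrite -!mulrA in H; exact: esym H.
exists p => //; rewrite -[RHS]pa; apply: eq_bigr => i _.
by rewrite !revrX; apply: rev_term.
Qed.

Lemma rational_algebraic_centroid (R : pzRingType) (iota : {rmorphism k -> R})
    (P : ideal R) : central_map iota -> rational iota P ->
  algebraic_centroid (factor_proj P \o iota).
Proof.
move=> ciota [/algebraic_center_centroid//|/algebraic_center_centroid].
apply: converse_algebraic_centroid => x u; have [r <-] := factor_proj_surj u.
by rewrite /= -!rmorphM ciota.
Qed.

Lemma factor_proj_polynomial (R : pzRingType) (iota : k -> R) (P : ideal R)
    (p : {poly k}) (a c : R) :
  \sum_(i < size p) (factor_proj P \o iota) p`_i * factor_proj P a ^+ i *
    factor_proj P c ^+ (size p - i) =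
  factor_proj P (\sum_(i < size p) iota p`_i * a ^+ i * c ^+ (size p - i)).
Proof.
by rewrite rmorph_sum; apply: eq_bigr => i _; rewrite !rmorphM !rmorphXn.
Qed.

End Centroid.

(** * Rational primes are locally closed *)

Section LocallyClosed.
Variables (k : fieldType) (R : pzRingType) (iota : {rmorphism k -> R}).
Variables (I P P' : ideal R) (D : set (factor_ring I)) (T : pzRingType).
Variable phi : {rmorphism factor_ring I -> T}.
Hypotheses (R_algebra : central_map iota) (denD : right_denominator_set D).
Hypotheses (locT : right_localization D phi) (noethT : right_noetherian T).
Hypotheses (commT : ideally_commutative T) (sIP : I `<=` P).
Hypotheses (primeP : prime_ideal P) (primeP' : prime_ideal P').
Hypothesis regP : forall d, D d -> regular_mod (image_ideal I P) d.
Hypothesis regP' : forall d, D d -> regular_mod (image_ideal I P') d.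

(* A central element of T generating more than P T is a fraction with numerator
   in P' outside P; its polynomial relation over k, divided by a power of the
   numerator, puts a power of the denominator in P'. *)
Lemma algebraic_centroid_maximal : algebraic_centroid (factor_proj P \o iota) ->
  P `<=` P' -> P' `<=` P.
Proof.
move=> algP sPP' n P'n; apply: contrapT => nPn.
have sIP' : I `<=` P' by apply: subset_trans sPP'.
pose N := image_ideal I P; pose N' := image_ideal I P'.
pose F := fractions D phi.
have FN'n : F N' (phi (factor_proj I n)).
  by apply: sub_fractions => //; apply/(image_idealE _ sIP').
(* Ideal commutativity writes the image of n as a sum of z_i b_i with z_i central in P' T. *)
have [extF _ _ _] := commT.
have := extF (Ideal (fractions_ideal denD locT N' noethT)).
move=> /(congr1 (fun X : set T => X (phi (factor_proj I n)))) /=.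
rewrite -/F => extFn; have : F N' (phi (factor_proj I n)) by [].
rewrite -extFn => -[m [z [b [zb phin]]]].
(* If all z_i were in P T, contraction would put n in P. *)
have [i nFz] : exists i, ~ F N (z i).
  apply: contrapT => /forallNP Fz; apply: nPn.
  apply/(image_idealE _ sIP)/(fractions_contract locT regP).
  rewrite -/F phin; apply: right_ideal_sum.
    exact/fractions_right_ideal/ideal_right_ideal.
  have [_ _ FM] := fractions_right_ideal denD locT (ideal_right_ideal N).
  by move=> i _; apply: FM; apply: contrapT; apply: Fz.
have [[[s [d' [N's Dd' zd]]] cz] _] := zb i; move: Dd' N's zd.
have [d <-] := factor_proj_surj d'; have [a <-] := factor_proj_surj s.
move=> Dd /(image_idealE _ sIP') P'a zd.
have nPa : ~ ideal_set P a.
  by move=> /(image_idealE _ sIP) Na; apply: nFz; exists (factor_proj I a), (factor_proj I d).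
have regd : regular_mod P d by exact/(image_ideal_regular sIP)/regP.
have regd' : regular_mod P' d by exact/(image_ideal_regular sIP')/regP'.
have axd x : ideal_set P (a * x * d - d * x * a).
  apply/sIP/factor_proj_eq; have [phi_inj _ _] := locT; apply: phi_inj.
  by rewrite !rmorphM -zd -!mulrA cz -!mulrA cz.
have [|p p0] := algP (factor_proj P a) _ (factor_regular regd).
  move=> u; have [x <-] := factor_proj_surj u.
  by have /factor_proj_eq := axd x; rewrite !rmorphM.
rewrite factor_proj_polynomial; move=> /factor_proj0.
(* Induction on the size of p: factors X are removed until the constant term is nonzero. *)
have [l] := ubnP (size p); elim: l p p0 => // l IHl p p0 ltpl.
have [p00|p00] := eqVneq p`_0 0.
  have [q Ep] : exists q, p = q * 'X.
    by exists (p %/ 'X); rewrite divpK // -['X]subr0 dvdp_XsubCl /root horner_coef0 p00.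
  have q0 : q != 0 by apply: contraNneq p0 => q0; rewrite Ep q0 mul0r.
  move: ltpl; rewrite Ep size_mulX // big_ord_recl coefMX /= rmorph0 !mul0r add0r.
  under eq_bigr do rewrite /bump /= add1n coefMX /= subSS exprS mulrA R_algebra
    -2!mulrA (mulrA (iota _)).
  move=> ltql; rewrite -big_distrr /= => Pay; apply: (IHl q q0 ltql).
  set y := (X in ideal_set P (a * X)) in Pay *.
  (* Modulo P, a x d y = d x a y = 0; since a is outside P, primeness gives d y in P, and d
     cancels. *)
  have [x|//|Pdy] := @prime_ideal_mul _ P a (d * y) primeP.
    apply: (@ideal_subl _ _ _ (d * x * a * y)).
      by rewrite (mulrA _ d) -mulrBl; apply/ideal_mulr/axd.
    by rewrite -mulrA; apply: ideal_mull.
  by case: regd => + _; apply.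
(* The constant term is now invertible. All other terms contain a, hence lie in P', so d^(size p) is
   in P' and cancelling d gives 1 in P'. *)
have size_p : size p = (size p).-1.+1 by rewrite prednK // size_poly_gt0.
rewrite size_p big_ord_recl expr0 mulr1 subn0 => /sPP' Pp.
apply: (prime_ideal_neq1 primeP'); apply: (regular_mod_exp regd' (n := (size p).-1.+1)).
rewrite -[d ^+ _]mul1r -(rmorph1 iota) -(mulVf p00) rmorphM -mulrA; apply: ideal_mull.
rewrite -[X in ideal_set _ X](addrK (\sum_(i < (size p).-1)
  iota p`_(lift ord0 i) * a ^+ (lift ord0 i) * d ^+ ((size p).-1.+1 - lift ord0 i))).
apply: idealB => //; elim/big_ind: _ => [||j _]; [exact: ideal0|exact: idealD|].
by rewrite lift0 exprS mulrA; do 2!apply: ideal_mulr; rewrite R_algebra; apply: ideal_mulr.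
Qed.

End LocallyClosed.

(** * Simple modules *)

Section RightAction.
Variables (R : pzRingType) (M : lmodType R^c).
Implicit Types (m : M) (r s : R).

Definition act m r : M := (r : R^c) *: m.

Lemma actA m r s : act (act m r) s = act m (r * s).
Proof. by rewrite /act scalerA. Qed.
Lemma act1 m : act m 1 = m.
Proof. by rewrite /act; apply: scale1r. Qed.
Lemma actDr m r s : act m (r + s) = act m r + act m s.
Proof. by rewrite /act scalerDl. Qed.
Lemma actBr m r s : act m (r - s) = act m r - act m s.
Proof. by rewrite /act scalerBl. Qed.
Lemma actDl m m' r : act (m + m') r = act m r + act m' r.
Proof. by rewrite /act scalerDr. Qed.
Lemma actBl m m' r : act (m - m') r = act m r - act m' r.
Proof. by rewrite /act scalerBr. Qed.
Lemma act0l r : act 0 r = 0.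
Proof. by rewrite /act scaler0. Qed.
Lemma act0r m : act m 0 = 0.
Proof. by rewrite /act; apply: scale0r. Qed.
Lemma act_suml (I : Type) (t : seq I) (F : I -> M) r :
  act (\sum_(i <- t) F i) r = \sum_(i <- t) act (F i) r.
Proof. by rewrite /act scaler_sumr. Qed.
Lemma act_sumr (I : Type) (t : seq I) m (F : I -> R) :
  act m (\sum_(i <- t) F i) = \sum_(i <- t) act m (F i).
Proof.
elim: t => [|i t IH]; first by rewrite !big_nil act0r.
by rewrite !big_cons actDr IH.
Qed.

End RightAction.

(* A central fraction a / c of R / P acts on a faithful simple module M by the
   endomorphism f with f(m) x c = m x a for all x in R. *)
Lemma primitive_algebraic_centroid (k : fieldType) (R : pzRingType)
    (iota : {rmorphism k -> R}) (P : ideal R) (M : lmodType R^c) :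
  central_map iota -> simple_module M -> annihilator M = P ->
  (forall f : {linear M -> M}, algebraic_endo iota f) ->
  algebraic_centroid (factor_proj P \o iota).
Proof.
move=> ciota [[m0 m0_neq0] simM] annM algM u w.
have [a <-] := factor_proj_surj u; have [c <-] := factor_proj_surj w.
move=> /regular_factor regc auc.
have annP r : ideal_set P r <-> forall m : M, act m r = 0 by rewrite -annM.
have axc x : ideal_set P (a * x * c - c * x * a).
  by apply/factor_proj_eq; rewrite !rmorphM; apply: auc.
have nP1 : ~ ideal_set P 1 by move=> /annP/(_ m0); rewrite act1.
(* The elements killed by Rc form a submodule; were it all of [M], c would lie in P, and regularity
   would give 1 in P. *)
have act_c_inj (m : M) : (forall x, act m (x * c) = 0) -> m = 0.
  move=> Hm; have [|N0|NT] := simM [set m : M | forall x, act m (x * c) = 0].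
  - split=> [x|m1 m2 H1 H2 x|r m1 H1 x] /=; first exact: act0l.
      by rewrite actDl H1 H2 addr0.
    by rewrite -[r *: m1]/(act m1 r) actA mulrA.
  - by have /seteqP[sN0 _] := N0; exact: sN0 Hm.
  - exfalso; apply: nP1; have [+ _] := regc; apply; rewrite mulr1.
    apply/annP => m1.
    by have /seteqP[_ /(_ m1 I)/(_ 1)] := NT; rewrite mul1r.
have act_c_inj2 (m m' : M) : (forall x, act m (x * c) = act m' (x * c)) -> m = m'.
  move=> eqmm'; apply/eqP; rewrite -subr_eq0; apply/eqP/act_c_inj => x.
  by rewrite actBl eqmm' subrr.
have act_ac (m : M) x : act m (a * x * c) = act m (c * x * a).
  by have /annP/(_ m)/eqP := axc x; rewrite actBr subr_eq0 => /eqP.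
(* The elements with an image form a submodule containing every m c, with image m a; were it 0, c
   would annihilate [M]. *)
have /choice[f fP] (m : M) : exists m' : M, forall x, act m (x * a) = act m' (x * c).
  have [|N0|NT] := simM [set m : M | exists m' : M, forall x, act m (x * a) = act m' (x * c)].
  - split=> [|m1 m2 [m1' H1] [m2' H2]|r m1 [m1' H1]].
    + by exists 0 => x; rewrite !act0l.
    + by exists (m1' + m2') => x; rewrite !actDl H1 H2.
    + exists (act m1' r) => x; rewrite -[r *: m1]/(act m1 r) !actA !mulrA.
      exact: H1.
  - exfalso; apply: nP1; have [+ _] := regc; apply; rewrite mulr1.
    apply/annP => m1.
    have /seteqP[sN0 _] := N0; apply: (sN0 (act m1 c)).
    by exists (act m1 a) => x; rewrite !actA !mulrA act_ac.
  - by have /seteqP[_ /(_ m I)] := NT.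
have flin : linear f.
  move=> r m m'; apply: act_c_inj2 => x; rewrite -fP.
  rewrite -[r *: m]/(act m r) -[r *: f m]/(act (f m) r) !actDl !actA !mulrA.
  by rewrite -!fP.
pose fL : {linear M -> M} := HB.pack f (GRing.isLinear.Build _ _ _ _ f flin).
have fc (m : M) : act (f m) c = act m a by have := fP m 1; rewrite !mul1r.
have fci i (m : M) : act (iter i f m) (c ^+ i) = act m (a ^+ i).
  elim: i => [|i IHi] //.
  rewrite iterS exprS -actA fc actA.
  have -> (y : M) : act y (a * c ^+ i) = act y (c ^+ i * a).
    elim: {IHi} i y => [|i IHi] y; first by rewrite mulr1 mul1r.
    rewrite exprS mulrA -actA.
    have := act_ac y 1; rewrite !mulr1 => ->.
    by rewrite actA -(mulrA c) -actA IHi actA mulrA.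
  by rewrite -actA IHi actA exprSr.
have [p p0 pf] := algM fL; exists p => //.
rewrite factor_proj_polynomial; apply/factor_proj0/annP => m.
(* Acting by c^(size p) on p(f)(m) = 0 turns each f^i(m) c^i into m a^i. *)
have := congr1 (fun y => act y (c ^+ size p)) (pf m).
rewrite act0l act_suml act_sumr => H; rewrite -[RHS]H; apply: eq_bigr => i _.
rewrite -[_ *: _]/(act (iter i f m) (iota p`_i)) actA.
have -> : iota p`_i * c ^+ size p = c ^+ i * (iota p`_i * c ^+ (size p - i)).
  by rewrite [RHS]mulrA -ciota -mulrA -exprD subnKC // ltnW.
by rewrite -[in RHS]actA fci actA [in RHS]mulrA ciota.
Qed.

(** * Simple modules from maximal right ideals *)

Record right_ideal (R : pzRingType) := RightIdeal {
  right_ideal_set :> set R;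
  right_idealP : is_right_ideal right_ideal_set }.

Section CyclicModule.
Variables (R : pzRingType) (B : right_ideal R).

Definition right_ideal_pred : {pred R} := fun x => `[< right_ideal_set B x >].

Fact right_ideal_zmod_closed : zmod_closed right_ideal_pred.
Proof.
have [B0 BD BM] := right_idealP B.
split=> [|x y /asboolP Bx /asboolP By]; apply/asboolP => //.
by apply: BD => //; rewrite -mulrN1; apply: BM.
Qed.

HB.instance Definition _ := GRing.isZmodClosed.Build R right_ideal_pred
  right_ideal_zmod_closed.

Definition cyclic_module := Quotient.quot right_ideal_pred.

HB.instance Definition _ := GRing.Zmodule.on cyclic_module.
HB.instance Definition _ := EqQuotient.on cyclic_module.

Definition coset (x : R) : cyclic_module := \pi_cyclic_module x.

Lemma coset_eq x y : coset x = coset y <-> right_ideal_set B (x - y).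
Proof.
rewrite /coset; split=> [/eqP|Bxy].
  by rewrite -Quotient.idealrBE => /asboolP.
by apply/eqP; rewrite -Quotient.idealrBE; apply/asboolP.
Qed.

Lemma coset_surj (u : cyclic_module) : exists x, coset x = u.
Proof. by exists (repr u); rewrite /coset reprK. Qed.

Lemma cosetD x y : coset (x + y) = coset x + coset y.
Proof. by rewrite /coset !piE. Qed.

Lemma coset0 x : coset x = 0 <-> right_ideal_set B x.
Proof.
have -> : 0 = coset 0 by rewrite /coset !piE.
by rewrite coset_eq subr0.
Qed.

Definition coset_scale (r : R^c) (u : cyclic_module) : cyclic_module :=
  coset (repr u * (r : R)).

Lemma coset_scaleE (r x : R) : coset_scale r (coset x) = coset (x * r).
Proof.
have [_ _ BM] := right_idealP B.
apply/coset_eq; rewrite -mulrBl; apply: BM; apply/coset_eq.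
by rewrite {1}/coset reprK.
Qed.

Fact coset_scaleA (r s : R^c) u :
  coset_scale r (coset_scale s u) = coset_scale (r * s) u.
Proof. by have [x <-] := coset_surj u; rewrite !coset_scaleE mulrA. Qed.
Fact coset_scale1 : left_id 1 coset_scale.
Proof. by move=> u; have [x <-] := coset_surj u; rewrite coset_scaleE mulr1. Qed.
Fact coset_scaleDr : right_distributive coset_scale +%R.
Proof.
move=> r u v; have [x <-] := coset_surj u; have [y <-] := coset_surj v.
by rewrite -cosetD !coset_scaleE mulrDl cosetD.
Qed.
Fact coset_scaleDl u : {morph coset_scale^~ u : r s / r + s}.
Proof.
move=> r s; have [x <-] := coset_surj u.
by rewrite !coset_scaleE mulrDr cosetD.
Qed.

HB.instance Definition _ := GRing.Zmodule_isLmodule.Build R^c cyclic_module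
  coset_scaleA coset_scale1 coset_scaleDr coset_scaleDl.

Lemma cyclic_module_simple : maximal_right_ideal B -> simple_module cyclic_module.
Proof.
move=> [_ nBT maxB]; have [B0 BD BM] := right_idealP B; split.
  exists (coset 1) => /coset0 B1; apply: nBT; apply/seteqP; split=> // x _.
  by rewrite -[x]mul1r; apply: BM.
move=> N [N0 ND NM].
have [||NB|NT] := maxB [set x | N (coset x)].
- split=> [|x y Nx Ny|x r Nx] /=.
  + by have -> : coset 0 = 0 by apply/coset0.
  + by rewrite cosetD; apply: ND.
  + by rewrite -coset_scaleE; apply: NM.
- by move=> x /coset0 x0; rewrite /= x0.
- left; apply/seteqP; split=> [u|_ -> //]; have [x <-] := coset_surj u => Nx.
  by apply/coset0; rewrite -NB.
- right; apply/seteqP; split=> // u _; have [x <-] := coset_surj u.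
  by have : [set x | N (coset x)] x by rewrite NT.
Qed.

Lemma cyclic_module_annihilator :
  annihilator cyclic_module = [set s | forall x, right_ideal_set B (x * s)].
Proof.
apply/seteqP; split=> [s Hs x|s Hs u].
  by apply/coset0; rewrite -coset_scaleE; apply: Hs.
have [x <-] := coset_surj u; rewrite -[LHS]/(coset_scale s (coset x)) coset_scaleE.
exact/coset0.
Qed.

End CyclicModule.

(** If C is not inside the core, maximality gives B + C = R, say 1 = b + d. Then x e = b x e + d x
    e, where b x e is in B and d x e is in C E, hence in the core. *)
Lemma maximal_right_ideal_core_prime (R : pzRingType) (B : set R) :
  maximal_right_ideal B ->
  exists2 P : ideal R, prime_ideal P & ideal_set P = [set s | forall x, B (x * s)].
Proof.
move=> [[B0 BD BM] nBT maxB].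
have nB1 : ~ B 1.
  move=> B1; apply: nBT; apply/seteqP; split=> // x _.
  by rewrite -[x]mul1r; apply: BM.
have idP : is_ideal [set s | forall x, B (x * s)].
  split=> [x|s t Bs Bt x|r s Bs x|s r Bs x]; rewrite /= ?mulr0 ?mulrDr ?mulrA //.
  - exact: BD.
  - exact: BM.
exists (Ideal idP) => //; split; first by exists 1 => /(_ 1); rewrite mulr1.
move=> C E sCE; have [sC|nsC] := pselect (C `<=` Ideal idP); first by left.
right=> e Ee x; move: nsC => /existsNP[c /not_implyP[Cc /existsNP[y nByc]]].
have [||BC|CT] := maxB [set b + d | b in B & d in C].
- split; first by exists 0 => //; exists 0; rewrite ?addr0 //; apply: ideal0.
  + move=> _ _ [b Bb [d Cd <-]] [b' Bb' [d' Cd' <-]].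
    exists (b + b'); first exact: BD.
    by exists (d + d'); [exact: idealD|rewrite addrACA].
  + move=> _ r [b Bb [d Cd <-]]; exists (b * r); first exact: BM.
    by exists (d * r); [exact: ideal_mulr|rewrite mulrDl].
- by move=> b Bb; exists b => //; exists 0; rewrite ?addr0 //; apply: ideal0.
- exfalso; apply: nByc; rewrite -BC; exists 0 => //.
  by exists (y * c); rewrite ?add0r //; apply: ideal_mull.
have : [set b + d | b in B & d in C] 1 by rewrite CT.
move=> [b Bb [d Cd bd1]]; rewrite -[x * e]mul1r -bd1 mulrDl; apply: BD.
  exact: BM.
have /(_ 1) : ideal_set (Ideal idP) (d * (x * e)).
  apply: sCE; exists 1%N, (fun=> d), (fun=> x * e); split.
    by move=> _; split=> //; apply: ideal_mull.
  by rewrite big_ord1.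
by rewrite mul1r.
Qed.

(** Take r outside P but in all larger primes. A maximal right ideal of R / P misses r; the core of
    its preimage is a prime above P without r, so it is P. *)
Lemma locally_closed_primitive (R : pzRingType) (P : ideal R) :
  jacobson_radical (factor_ring P) `<=` [set 0] -> locally_closed P -> primitive_ideal P.
Proof.
move=> J0 [_ /existsNP[r /not_implyP[Qr nPr]]].
have : ~ jacobson_radical (factor_ring P) (factor_proj P r).
  by move=> /J0/factor_proj0.
move=> /existsNP[B /not_implyP[maxB nBr]].
have [[B0 BD BM] nBT HB] := maxB.
pose B' := factor_proj P @^-1` B.
have idB' : is_right_ideal B'.
  split=> [|x y|x s]; rewrite /B' /= ?rmorph0 ?rmorphD ?rmorphM //; [exact: BD|exact: BM].
(* A right ideal above the preimage contains P, so it is determined by its image in R / P. *)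
have maxB' : maximal_right_ideal B'.
  split=> // [B'T|C [C0 CD CM] sB'C].
    apply: nBT; apply/seteqP; split=> // u _; have [x <-] := factor_proj_surj u.
    by rewrite -[B _]/(B' x) B'T.
  have sPC x : ideal_set P x -> C x.
    by move=> Px; apply: sB'C; rewrite /B' /=; move/factor_proj0: Px => ->.
  have CE x : [set u | exists2 y, C y & factor_proj P y = u] (factor_proj P x) -> C x.
    move=> [y Cy /esym/factor_proj_eq/sPC Cxy].
    by rewrite -[x](subrK y); apply: CD.
  have [||EB|ET] := HB [set u | exists2 y, C y & factor_proj P y = u].
  - split; first by exists 0; rewrite ?rmorph0.
    + by move=> _ _ [x Cx <-] [y Cy <-]; exists (x + y); rewrite ?rmorphD //; apply: CD.
    + move=> _ v [x Cx <-]; have [y <-] := factor_proj_surj v.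
      by exists (x * y); rewrite ?rmorphM //; apply: CM.
  - by move=> u; have [x <-] := factor_proj_surj u => /(sB'C x) Cx; exists x.
  - left; apply/seteqP; split=> x; last exact: sB'C.
    by move=> Cx; rewrite /B' /= -EB; exists x.
  - by right; apply/seteqP; split=> // x _; apply: CE; rewrite ET.
have [Q primeQ eqQ] := maximal_right_ideal_core_prime maxB'.
have sPQ : P `<=` Q.
  rewrite eqQ => s Ps x; rewrite /B' /=.
  by have /factor_proj0 -> : ideal_set P (x * s) by apply: ideal_mull.
exists (cyclic_module (RightIdeal idB')); split; first exact: cyclic_module_simple.
rewrite cyclic_module_annihilator /= -eqQ; apply/seteqP; split=> //.
apply: contrapT => nsQP; apply: nBr; rewrite -[B _]/(B' r) -[r]mul1r.
have : ideal_set Q r by apply: Qr; split=> //; split.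
by rewrite eqQ; apply.
Qed.

(** * The Dixmier-Moeglin equivalence *)

(** Condition (B) read in R: a prime containing I but not J has its image in Y. *)
Lemma denominators_regular_mod (R : pzRingType) (I J P : ideal R)
    (D : set (factor_ring I)) :
  Spec (factor_ring I) `\` zariski_closed (factor_proj I @` sums J I) =
    [set Q | Spec (factor_ring I) Q /\ D `<=` regular_mod Q] ->
  prime_ideal P -> I `<=` P -> ~ J `<=` P ->
  forall d, D d -> regular_mod (image_ideal I P) d.
Proof.
move=> eqY primeP sIP nsJP.
have : [set Q | Spec (factor_ring I) Q /\ D `<=` regular_mod Q] (image_ideal I P).
  rewrite -eqY; split; first exact: image_ideal_prime.
  move=> [_ sJQ]; apply: nsJP => j Jj; apply/(image_idealE _ sIP)/sJQ.
  exists j => //; exists j => //; exists 0; [exact: ideal0|exact: addr0].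
by case.
Qed.

Unset Implicit Arguments.

Theorem mainTheorem2
  (k : fieldType) (R : pzRingType) (iota : {rmorphism k -> R})
  (R_algebra : central_map iota)
  (t : nat) (I J : 'I_t -> ideal R)
  (Spec_cover : Spec R =
     \bigcup_l (zariski_closed (I l) `\` zariski_closed (J l)))
  (D : forall l, set (factor_ring (I l)))
  (D_denominator : forall l, right_denominator_set (D l))
  (T : 'I_t -> pzRingType)
  (phi : forall l, {rmorphism factor_ring (I l) -> T l})
  (T_localization : forall l, right_localization (D l) (phi l))
  (hypA : forall l, right_noetherian (T l))
  (hypB : forall l,
     Spec (factor_ring (I l)) `\`
       zariski_closed (factor_proj (I l) @` sums (J l) (I l)) =
     [set Q | Spec (factor_ring (I l)) Q /\ D l `<=` regular_mod Q])
  (hypC : forall l, ideally_commutative (T l))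
  (hypD : nullstellensatz iota) :
  dixmier_moeglin iota.
Proof.
move=> P primeP; have [algEnd nilJ] := hypD.
have : Spec R P by [].
rewrite {1}Spec_cover => -[l _ [[_ sIP] nJP]].
have {nJP} nsJP : ~ J l `<=` P by move=> sJP; apply: nJP.
have regD P' := @denominators_regular_mod R (I l) (J l) P' (D l) (hypB l).
have primeA := factor_prime_ring primeP.
have goldieA : right_goldie (factor_ring P).
  apply: noetherian_up_to_regular_goldie.
  exact: (factor_noetherian_up_to_regular (D_denominator l) (T_localization l)
    (hypA l) sIP (regD P primeP sIP nsJP)).
have prim_rat : primitive_ideal P -> rational iota P.
  move=> [M [simM annM]]; left; apply: centroid_algebraic_center => //.
  exact: (primitive_algebraic_centroid R_algebra simM annM (algEnd M simM)).
have rat_closed : rational iota P -> locally_closed P.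
  move=> /(rational_algebraic_centroid R_algebra) algP.
  split=> [x Px Q [_ [sPQ _]]|sQP]; first exact: sPQ.
  (* If the intersection of the primes strictly above P lay in P, so would J_l, which each of these
     primes contains. *)
  apply: (nsJP) => j Jj; apply: sQP => Q [primeQ [sPQ nsQP]].
  have [sJQ|nsJQ] := pselect (J l `<=` Q); first exact: sJQ.
  exfalso; apply: nsQP.
  have sIQ := subset_trans sIP sPQ.
  exact: (algebraic_centroid_maximal R_algebra (D_denominator l) (T_localization l)
    (hypA l) (hypC l) sIP primeP primeQ (regD P primeP sIP nsJP)
    (regD Q primeQ sIQ nsJQ) algP sPQ).
have closed_prim : locally_closed P -> primitive_ideal P.
  apply: locally_closed_primitive; have [accA _] := goldieA.
  (* The Jacobson radical is nil by the Nullstellensatz and stable under right multiplication, so it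
     vanishes. *)
  move=> u; apply: (nil_right_stable_eq0 accA primeA _ (nilJ P)) => x y Jx B maxB.
  by have [[_ _ BM] _ _] := maxB; exact: (BM _ _ (Jx B maxB)).
by split; split; auto.
Qed.
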